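(* Let $c\in(0,1)$ and $C>0$ be constants, $p=w(n)/n$ with $\log^4n\ll w(n)<cn$, and $k=C\,w(n)^{1/2}$. Let $G\sim G(n,p)$ on vertex set $V=[n]$. For $K\subset V$ with $|K|=k$ and $i\in V\setminus K$ let $X_i$ be the number of neighbors of $i$ in $K$. Then with probability at least $1-\exp(-2k\log n)$, for every choice of $K\subset V$ with $|K|=k$, \[\sum_{i\in V\setminus K}(X_i-kp)^2\le (n-k)kp(1-p)+o(nkp(1-p)),\] where the $o(nkp(1-p))$ term is a function of $n$ only (not depending on $K$).
   Context: $G(n,p)$ is the Erdős–Rényi random graph with edge probability $p$. $f\ll g$ means $f/g\to0$. Logarithms base $2$. *)

(* Defs.v *)
From HB Require Import structures.
From mathcomp Require Import all_boot all_order all_algebra.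
From mathcomp Require Import all_classical all_reals all_analysis.
Set Implicit Arguments. Unset Strict Implicit. Unset Printing Implicit Defensive.
Import Order.TTheory GRing.Theory Num.Theory.
Local Open Scope ring_scope.

(* Potential edges of a simple graph on vertex set [n] = 'I_n: 2-subsets. *)
Definition pairs (n : nat) : {set {set 'I_n}} := [set e : {set 'I_n} | #|e| == 2%N].

(* A simple graph on 'I_n is an edge set E \subset pairs n. *)
Definition adj (n : nat) (E : {set {set 'I_n}}) (i j : 'I_n) : bool :=
  [set i; j] \in E.

(* Probability, under G(n,p), that the random edge set satisfies A:
   each of the #|pairs n| potential edges is present independently with prob. p. *)
Definition gnp_prob (R : realType) (n : nat) (p : R)
    (A : pred {set {set 'I_n}}) : R :=
  \sum_(E in powerset (pairs n) | A E)
     p ^+ #|E| * (1 - p) ^+ (#|pairs n| - #|E|).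

Definition nbr_count (n : nat) (E : {set {set 'I_n}}) (K : {set 'I_n})
    (i : 'I_n) : nat :=
  #|[set j in K | adj E i j]|.

Definition kk (R : realType) (C : R) (w : nat -> R) (n : nat) : nat :=
  Num.truncn (C * Num.sqrt (w n)).

Definition pp (R : realType) (w : nat -> R) (n : nat) : R := w n / n%:R.

Definition log2 (R : realType) (x : R) : R := ln x / ln 2.

(* Main.v *)
Require Import Defs.
From HB Require Import structures.
From mathcomp Require Import all_boot all_order all_algebra.
From mathcomp Require Import all_classical all_reals all_analysis.
From mathcomp Require Import ring lra.
Set Implicit Arguments.
Unset Strict Implicit.
Unset Printing Implicit Defensive.
Import Order.TTheory GRing.Theory Num.Theory.
Local Open Scope ring_scope.

(** Chernoff bound and union bound over the at most n^k sets K. For fixed K the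
    degrees X_i depend on disjoint sets of potential edges, so it suffices to
    bound E exp(l (X - kp)^2) for one binomial X. Summands of size k^2 would
    make Bernstein's inequality lose a factor log n; instead, since
    |X - kp| <= k, the exponent l (X - kp)^2 is at most l k |X - kp|, and
    l k -> 0 for the required l ~ (log n)/w. The second order term is thereby
    controlled by the moment generating function of X - kp at the scale
    s = 1 / (2 sqrt (1 + kp)), which gives
    E exp(l (X - kp)^2) <= exp(l kp(1-p) + O(l^2 kp (1 + kp))).
    If w n <= 0 then k = 0 and the claim is trivial; for small n the error
    f n is merely taken large. *)

(** * Expectation over a random subset with independent elements *)

(** The mean of [f] at a random subset of [A] that contains each element independently with
    probability [p]. Keeping the ground set [A] as a parameter permits induction on it and
    restriction to smaller sets. The identities below hold for every real [p]; only monotonicity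
    asks for [0 <= p <= 1]. *)
Definition bexp (R : realType) (T : finType) (p : R) (A : {set T})
    (f : {set T} -> R) : R :=
  \sum_(E in powerset A) p ^+ #|E| * (1 - p) ^+ (#|A| - #|E|) * f E.

Lemma eq_bexp (R : realType) (T : finType) (p : R) (A : {set T})
    (f g : {set T} -> R) :
  (forall E : {set T}, E \subset A -> f E = g E) -> bexp p A f = bexp p A g.
Proof.
by move=> fg; apply: eq_bigr => E; rewrite powersetE => /fg ->.
Qed.

Lemma le_bexp (R : realType) (T : finType) (p : R) (A : {set T})
    (f g : {set T} -> R) :
  0 <= p <= 1 -> (forall E : {set T}, E \subset A -> f E <= g E) ->
  bexp p A f <= bexp p A g.
Proof.
move=> /andP[p0 p1] fg; apply: ler_sum => E; rewrite powersetE => /fg fgE.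
by rewrite ler_wpM2l // mulr_ge0 // exprn_ge0 // subr_ge0.
Qed.

Lemma bexpD (R : realType) (T : finType) (p : R) (A : {set T})
    (f g : {set T} -> R) :
  bexp p A (fun E => f E + g E) = bexp p A f + bexp p A g.
Proof. by rewrite -big_split; apply: eq_bigr => E _; rewrite mulrDr. Qed.

Lemma bexpZ (R : realType) (T : finType) (p a : R) (A : {set T})
    (f : {set T} -> R) :
  bexp p A (fun E => a * f E) = a * bexp p A f.
Proof. by rewrite /bexp mulr_sumr; apply: eq_bigr => E _; rewrite mulrCA. Qed.

Lemma bexp_sum (R : realType) (T I : finType) (P : pred I) (p : R)
    (A : {set T}) (f : I -> {set T} -> R) :
  bexp p A (fun E => \sum_(i | P i) f i E) = \sum_(i | P i) bexp p A (f i).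
Proof.
by rewrite exchange_big; apply: eq_bigr => E _; rewrite mulr_sumr.
Qed.

Lemma bexp_set0 (R : realType) (T : finType) (p : R) (f : {set T} -> R) :
  bexp p finset.set0 f = f finset.set0.
Proof.
by rewrite /bexp powerset0 big_set1 cards0 !expr0 !mul1r.
Qed.

(** Conditioning on whether [e] is chosen. This recursion drives all later inductions on the ground
    set. *)
Lemma bexp_setU1 (R : realType) (T : finType) (p : R) (e : T) (A : {set T})
    (f : {set T} -> R) : e \notin A ->
  bexp p (e |: A) f = p * bexp p A (fun E => f (e |: E)) + (1 - p) * bexp p A f.
Proof.
move=> eA; rewrite /bexp (bigID (fun E : {set T} => e \in E)) /=.
congr (_ + _).
  rewrite mulr_sumr.
  (* Sets containing [e] correspond to subsets of [A] by removing [e]. *)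
  rewrite (reindex_onto (fun E : {set T} => e |: E) (fun E => E :\ e)) /=; last first.
    by move=> E /andP[_ eE]; rewrite finset.setD1K.
  apply: eq_big => [E|E].
    rewrite !powersetE setU11 andbT.
    apply/andP/idP => [[sE /eqP <-]|sE].
      by rewrite -(setU1K eA) finset.setSD.
    rewrite finset.setUS // setU1K //; apply: contra eA => eE.
    by apply: (fintype.subsetP sE).
  rewrite powersetE setU11 andbT => /andP[sE /eqP EE].
  have eE : e \notin E by rewrite -EE !inE eqxx.
  by rewrite !cardsU1 eA eE !add1n subSS exprS -!mulrA.
rewrite mulr_sumr; apply: eq_big => [E|E].
  rewrite !powersetE; apply/andP/idP => [[sE eE]|sE].
    apply/fintype.subsetP => x xE; move/fintype.subsetP: sE => /(_ x xE).
    by rewrite !inE => /orP[/eqP xe|//]; rewrite -xe xE in eE.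
  split; first exact: fintype.subset_trans sE (finset.subsetUr _ _).
  by apply: contra eA => eE; apply: (fintype.subsetP sE).
rewrite powersetE => /andP[sE eE].
have sEA : E \subset A.
  apply/fintype.subsetP => x xE; move/fintype.subsetP: sE => /(_ x xE).
  by rewrite !inE => /orP[/eqP xe|//]; rewrite -xe xE in eE.
by rewrite cardsU1 eA add1n subSn ?subset_leq_card // exprS !mulrA (mulrC (1 - p)).
Qed.

Lemma finset_ind (T : finType) (P : {set T} -> Prop) :
  P finset.set0 -> (forall e (A : {set T}), e \notin A -> P A -> P (e |: A)) ->
  forall A, P A.
Proof.
move=> P0 PS A; move: {2}#|A| (leqnn #|A|) => n.
elim: n A => [|n IH] A; first by rewrite leqn0 cards_eq0 => /eqP ->.
have [->//|[e eA]] := set_0Vmem A.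
rewrite (cardsD1 e) eA add1n ltnS => /IH PA.
by rewrite -(finset.setD1K eA); apply: PS => //; rewrite !inE eqxx.
Qed.

(** Independence of the traces on two disjoint sets. The induction keeps [f] general, since
    conditioning on [e] replaces [f] by [fun E => f (e |: E)]. *)
Lemma bexp_setU (R : realType) (T : finType) (p : R) (A B : {set T})
    (f g : {set T} -> R) : [disjoint A & B] ->
  bexp p (A :|: B) (fun E => f (E :&: A) * g (E :&: B)) = bexp p A f * bexp p B g.
Proof.
elim/finset_ind: A f => [|e A eA IH] f.
  rewrite finset.set0U bexp_set0 -bexpZ => _; apply: eq_bexp => E EB.
  by rewrite finset.setI0 (finset.setIidPl EB).
move=> dAB.
have eB : e \notin B.
  by apply/negP => eB; move/pred0P: dAB => /(_ e); rewrite /= !inE eqxx eB.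
have dAB' : [disjoint A & B].
  by apply: disjointWl dAB; apply/fintype.subsetP => x xA; rewrite inE xA orbT.
have eAB : e \notin A :|: B by rewrite inE negb_or eA.
rewrite -finset.setUA (bexp_setU1 _ _ eAB) (bexp_setU1 _ _ eA).
rewrite [RHS]mulrDl -!mulrA -(IH f) // -(IH (fun E => f (e |: E))) //.
congr (_ * _ + _ * _).
  apply: eq_bexp => E EAB; rewrite -finset.setUIr; congr (_ * g _).
  apply/finset.setP => x; rewrite !inE; case: eqVneq => [->|//].
  by rewrite (negbTE eB) !andbF.
apply: eq_bexp => E EAB; congr (f _ * _).
apply/finset.setP => x; rewrite !inE; case: eqVneq => [->|//].
rewrite (negbTE eA) andbF; apply/negP => /andP[/(fintype.subsetP EAB)].
by rewrite !inE (negbTE eA) (negbTE eB).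
Qed.

(** Independence for a whole family, splitting [P] into [A i] and its complement in [P] at each
    step. The [A i] may leave part of [P] uncovered. *)
Lemma bexp_prod (R : realType) (T I : finType) (p : R) (P : {set T})
    (A : I -> {set T}) (g : I -> {set T} -> R) (r : seq I) :
  uniq r -> (forall i, i \in r -> A i \subset P) ->
  {in r &, forall i j, i != j -> [disjoint A i & A j]} ->
  bexp p P (fun E => \prod_(i <- r) g i (E :&: A i)) =
  \prod_(i <- r) bexp p (A i) (g i).
Proof.
elim: r P => [|i r IH] P /=.
  move=> _ _ _; rewrite big_nil.
  (* With no factor left, the claim is that the weights of the subsets of [P] sum to 1. *)
  elim/finset_ind: P => [|e P eP IH]; first by rewrite bexp_set0 big_nil.
  rewrite bexp_setU1 // (eq_bexp _ (g := fun=> 1)); last by move=> E _; rewrite big_nil.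
  rewrite [X in _ + _ * X](eq_bexp _ (g := fun=> 1)); last by move=> E _; rewrite big_nil.
  have -> : bexp p P (fun=> 1) = 1.
    by rewrite -[RHS]IH; apply: eq_bexp => E _; rewrite big_nil.
  by rewrite !mulr1 addrC subrK.
move=> /andP[ir ur] sP dA.
have iP : A i \subset P by apply: sP; rewrite inE eqxx.
rewrite big_cons -(IH (P :\: A i)) //.
- rewrite -bexp_setU; last first.
    by rewrite finset.disjoints_subset finset.setCD finset.subsetUr.
  have -> : A i :|: P :\: A i = P.
    by rewrite -{1}(finset.setIidPr iP) finset.setID.
  apply: eq_bexp => E EP; rewrite big_cons; congr (_ * _).
  apply: eq_big_seq => j jr; rewrite -finset.setIA; congr (g _ (_ :&: _)).
  have dij : [disjoint A i & A j].
    apply: dA; rewrite ?inE ?eqxx ?jr ?orbT //.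
    by apply: contraNneq ir => ->.
  apply/esym/finset.setIidPr; rewrite finset.subsetD sP ?inE ?jr ?orbT //=.
  by rewrite disjoint_sym.
- move=> j jr; rewrite finset.subsetD sP ?inE ?jr ?orbT //= disjoint_sym.
  apply: dA; rewrite ?inE ?eqxx ?jr ?orbT //.
  by apply: contraNneq ir => ->.
- by move=> j l jr lr; apply: dA; rewrite inE ?jr ?lr orbT.
Qed.

Lemma bexp1 (R : realType) (T : finType) (p : R) (A : {set T}) :
  bexp p A (fun=> 1) = 1.
Proof.
elim/finset_ind: A => [|e A eA IH]; first by rewrite bexp_set0.
by rewrite bexp_setU1 // IH !mulr1 addrC subrK.
Qed.

Lemma bexp_exp_card (R : realType) (T : finType) (p s : R) (A : {set T}) :
  bexp p A (fun E => expR (s * #|E|%:R)) = (1 - p + p * expR s) ^+ #|A|.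
Proof.
elim/finset_ind: A => [|e A eA IH].
  by rewrite bexp_set0 !cards0 mulr0 expR0 expr0.
rewrite bexp_setU1 // cardsU1 eA add1n exprS.
rewrite (eq_bexp _ (g := fun E => expR s * expR (s * #|E|%:R))); last first.
  move=> E EA; rewrite cardsU1 (contra (fintype.subsetP EA e) eA) add1n.
  by rewrite -expRD -natr1 mulrDr mulr1 addrC.
by rewrite bexpZ IH; ring.
Qed.

(** Variance plus squared bias of a binomial variable. The centre [a] is arbitrary because choosing
    [e] shifts it to [a - 1] in the induction. *)
Lemma bexp_var (R : realType) (T : finType) (p a : R) (A : {set T}) :
  bexp p A (fun E => (#|E|%:R - a) ^+ 2) =
  #|A|%:R * p * (1 - p) + (#|A|%:R * p - a) ^+ 2.
Proof.
elim/finset_ind: A a => [|e A eA IH] a.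
  by rewrite bexp_set0 !cards0; ring.
rewrite bexp_setU1 // cardsU1 eA add1n IH.
rewrite (eq_bexp _ (g := fun E => (#|E|%:R - (a - 1)) ^+ 2)); last first.
  move=> E EA; rewrite cardsU1 (contra (fintype.subsetP EA e) eA) add1n.
  by rewrite -natr1; congr (_ ^+ 2); ring.
by rewrite IH -natr1; ring.
Qed.

(** * Elementary inequalities for the exponential *)

(** From [1 - x <= expR (- x)] follows [expR x - 1 <= x * expR x]; applying this twice gives the
    claim. *)
Lemma expR_le_taylor2 (R : realType) (x : R) :
  0 <= x -> expR x <= 1 + x + x ^+ 2 * expR x.
Proof.
move=> x0; have e0 := expR_gt0 x.
have h : expR x - 1 <= x * expR x.
  have := expR_ge1Dx (- x); rewrite expRN => h.
  have := ler_wpM2l (ltW e0) h; rewrite divff ?gt_eqF // => h'.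
  lra.
nra.
Qed.

(** Here [expR s <= 1 / (1 - s)], and [(1 - s) (1 + s + 2 s^2) = 1 + s^2 (1 - 2 s)] is at least 1.
    Negative [s] is included, so both tails are covered. *)
Lemma expR_le_quad (R : realType) (s : R) :
  s <= 2^-1 -> expR s <= 1 + s + 2 * s ^+ 2.
Proof.
move=> s1; have s0 : 0 < 1 - s by lra.
have := expR_ge1Dx (- s); rewrite expRN => h.
have e0 := expR_gt0 s.
have h' : expR s <= (1 - s)^-1.
  by rewrite -[expR s]invrK lef_pV2 ?posrE ?invr_gt0.
apply: (le_trans h'); rewrite -div1r ler_pdivrMr //; nra.
Qed.

(** With [x = expR (u / 4)] the right side is [1024 (x^2 - x^-2)^2], and [x^2 - x^-2 >= (x - 1) x].
    The quadratic Taylor term of [x] gives [u^2 <= 32 (x - 1)], whence [1024 = 32^2]. *)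
Lemma exp_div4_bound (R : realType) (u : R) : 0 <= u ->
  u ^+ 4 * expR (u / 2) <= 1024 * (expR u + expR (- u) - 2).
Proof.
move=> u0; set x := expR (u / 4).
have x0 : 0 < x by apply: expR_gt0.
have x1 : u ^+ 2 <= 32 * (x - 1).
  have := @expR_ge1Dxn R (u / 4) 1; rewrite -/x => /(_ _)/wrap[]; first by lra.
  rewrite (_ : (2`!)%:R = 2 :> R) // => h; lra.
have -> : expR (u / 2) = x ^+ 2.
  by rewrite /x -expRM_natl; congr expR; field.
have -> : expR u = x ^+ 4.
  by rewrite /x -expRM_natl; congr expR; field.
have -> : expR (- u) = (x ^+ 4)^-1.
  by rewrite expRN; congr (_^-1); rewrite /x -expRM_natl; congr expR; field.
have x1' : 1 <= x by nra.
have -> : x ^+ 4 + (x ^+ 4)^-1 - 2 = ((x + 1) * (x ^+ 2 + 1) * (x - 1) / x ^+ 2) ^+ 2.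
  by field; rewrite gt_eqF.
have h : (x - 1) * x <= (x + 1) * (x ^+ 2 + 1) * (x - 1) / x ^+ 2.
  rewrite ler_pdivlMr ?exprn_gt0 //.
  have : 0 <= (x - 1) * (x ^+ 2 + x + 1) by apply: mulr_ge0; nra.
  by move=> h; nra.
have h2 : u ^+ 4 <= 1024 * (x - 1) ^+ 2.
  have u2 : 0 <= u ^+ 2 by apply: sqr_ge0.
  rewrite (_ : u ^+ 4 = u ^+ 2 * u ^+ 2); last by ring.
  rewrite (_ : 1024 * _ = (32 * (x - 1)) * (32 * (x - 1))); last by ring.
  by apply: ler_pM.
have h3 : ((x - 1) * x) ^+ 2 <= ((x + 1) * (x ^+ 2 + 1) * (x - 1) / x ^+ 2) ^+ 2.
  apply: lerXn2r => //; rewrite ?nnegrE; last apply: le_trans h.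
    by apply: mulr_ge0; lra.
  by apply: mulr_ge0; lra.
apply: (@le_trans _ _ (1024 * (x - 1) ^+ 2 * x ^+ 2)).
  by rewrite ler_wpM2r // sqr_ge0.
by rewrite -mulrA -exprMn (ler_wpM2l (ler0n _ _)).
Qed.

(** * Exponential moments of a centred binomial variable *)

Lemma bexp_mgf_le (R : realType) (T : finType) (p s : R) (A : {set T}) :
  0 <= p <= 1 -> s <= 2^-1 ->
  bexp p A (fun E => expR (s * (#|E|%:R - #|A|%:R * p))) <=
  expR (2 * (#|A|%:R * p * s ^+ 2)).
Proof.
move=> /andP[p0 p1] s2.
rewrite (eq_bexp _ (g := fun E =>
  expR (- (s * (#|A|%:R * p))) * expR (s * #|E|%:R))); last first.
  by move=> E _; rewrite -expRD mulrBr addrC.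
rewrite bexpZ bexp_exp_card.
have h : 1 - p + p * expR s <= expR (p * s + 2 * (p * s ^+ 2)).
  apply: le_trans (expR_ge1Dx _).
  have := expR_le_quad s2; nra.
have h0 : 0 <= 1 - p + p * expR s.
  by have := expR_gt0 s; nra.
have h2 : (1 - p + p * expR s) ^+ #|A| <= expR (#|A|%:R * (p * s + 2 * (p * s ^+ 2))).
  by rewrite expRM_natl; apply: lerXn2r; rewrite ?nnegrE ?expR_ge0.
apply: (le_trans (ler_wpM2l (expR_ge0 _) h2)).
by rewrite -expRD ler_expR; lra.
Qed.

(** Subtracting 2 removes the constant term. With [v = k p s^2], both exponential moments are at
    most [expR (2 v)], and [2 (expR (2 v) - 1) <= 4 v + 16 v^2 <= 8 v] because [v <= 1/4]. *)
Lemma bexp_cosh_le (R : realType) (T : finType) (p s : R) (A : {set T}) :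
  0 <= p <= 1 -> 0 <= s <= 2^-1 -> #|A|%:R * p * s ^+ 2 <= 4^-1 ->
  bexp p A (fun E => expR (s * (#|E|%:R - #|A|%:R * p)) +
                     expR (- (s * (#|E|%:R - #|A|%:R * p))) - 2) <=
  8 * (#|A|%:R * p * s ^+ 2).
Proof.
move=> p01 /andP[s0 s1] ks.
have p0 : 0 <= p by case/andP: p01.
set v := #|A|%:R * p * s ^+ 2 in ks *.
have v0 : 0 <= v by rewrite /v !mulr_ge0 // sqr_ge0.
rewrite bexpD bexpD.
rewrite [X in _ + X + _](eq_bexp _ (g := fun E =>
  expR ((- s) * (#|E|%:R - #|A|%:R * p)))); last first.
  by move=> E _; rewrite mulNr.
rewrite [X in _ + X](eq_bexp _ (g := fun E => (- 2) * 1)); last first.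
  by move=> E _; rewrite mulr1.
rewrite bexpZ bexp1 mulr1.
have h1 := bexp_mgf_le A p01 s1.
have h2 : bexp p A (fun E => expR ((- s) * (#|E|%:R - #|A|%:R * p))) <= expR (2 * v).
  have s1' : - s <= 2^-1 by lra.
  by have := bexp_mgf_le A p01 s1'; rewrite sqrrN.
have h3 : expR (2 * v) <= 1 + 2 * v + 2 * (2 * v) ^+ 2 by apply: expR_le_quad; lra.
rewrite -/v in h1.
have h4 : v * v <= 4^-1 * v by rewrite ler_wpM2r.
nra.
Qed.

(* On |y| <= k one has l y^2 <= l k |y|: this linearisation is what lets the
   tilted fourth moment be dominated by the moment generating function. *)
Lemma expR_sqr_le (R : realType) (l s k y : R) :
  0 <= l -> 0 < s -> 2 * (l * k) <= s -> `|y| <= k ->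
  expR (l * y ^+ 2) <= 1 + l * y ^+ 2 +
    l ^+ 2 / s ^+ 4 * 1024 * (expR (s * y) + expR (- (s * y)) - 2).
Proof.
move=> l0 s0 lks yk.
have ly0 : 0 <= l * y ^+ 2 by rewrite mulr_ge0 // sqr_ge0.
apply: (le_trans (expR_le_taylor2 ly0)).
rewrite lerD2l.
have h1 : l * y ^+ 2 <= s * `|y| / 2.
  rewrite -real_normK ?num_real // expr2.
  have : l * (`|y| * `|y|) <= l * (k * `|y|) by rewrite ler_wpM2l // ler_wpM2r.
  have : 2 * (l * k) * `|y| <= s * `|y| by rewrite ler_wpM2r.
  lra.
have h2 : (l * y ^+ 2) ^+ 2 * expR (l * y ^+ 2) <=
    (l * y ^+ 2) ^+ 2 * expR (s * `|y| / 2).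
  by rewrite ler_wpM2l ?sqr_ge0 // ler_expR.
apply: (le_trans h2).
have sy0 : 0 <= s * `|y| by rewrite mulr_ge0 // ltW.
(* Used at [u = s |y|], whose factor [expR (u / 2)] matches the linearised exponent; the right side
   is even in [y], so [|y|] can be replaced by [y]. *)
have h3 := exp_div4_bound sy0.
have -> : expR (s * y) + expR (- (s * y)) = expR (s * `|y|) + expR (- (s * `|y|)).
  by have [y0|y0] := ger0P y; rewrite ?mulrN ?opprK // addrC.
have -> : (l * y ^+ 2) ^+ 2 = l ^+ 2 / s ^+ 4 * (s * `|y|) ^+ 4.
  rewrite !exprMn (_ : `|y| ^+ 4 = (`|y| ^+ 2) ^+ 2); last by rewrite -exprM.
  by rewrite real_normK ?num_real //; field; rewrite gt_eqF.
have ls0 : 0 <= l ^+ 2 / s ^+ 4.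
  by rewrite mulr_ge0 ?sqr_ge0 // invr_ge0 exprn_ge0 // ltW.
have := ler_wpM2l ls0 h3; rewrite !mulrA.
by [].
Qed.

(** Average the pointwise bound [expR_sqr_le]: its quadratic term yields the variance, its last term
    is controlled by [bexp_cosh_le], and [1 + z <= expR z] restores an exponential. *)
Lemma bexp_expR_sqr_le (R : realType) (T : finType) (p l s : R) (A : {set T}) :
  0 <= p <= 1 -> 0 <= l -> 0 < s <= 2^-1 ->
  #|A|%:R * p * s ^+ 2 <= 4^-1 -> 2 * (l * #|A|%:R) <= s ->
  bexp p A (fun E => expR (l * (#|E|%:R - #|A|%:R * p) ^+ 2)) <=
  expR (l * (#|A|%:R * p * (1 - p)) + 8 * 1024 * (l ^+ 2 * (#|A|%:R * p) / s ^+ 2)).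
Proof.
move=> p01 l0 /andP[s0 s1] ks lks.
have /andP[p0 p1] := p01.
apply: le_trans (expR_ge1Dx _).
pose g (E : {set T}) := 1 + l * (#|E|%:R - #|A|%:R * p) ^+ 2 +
  l ^+ 2 / s ^+ 4 * 1024 * (expR (s * (#|E|%:R - #|A|%:R * p)) +
    expR (- (s * (#|E|%:R - #|A|%:R * p))) - 2).
have fg (E : {set T}) : E \subset A -> expR (l * (#|E|%:R - #|A|%:R * p) ^+ 2) <= g E.
  move=> EA; apply: expR_sqr_le lks _ => //.
  have EA' : #|E|%:R <= #|A|%:R :> R by rewrite ler_nat subset_leq_card.
  have E0 : 0 <= #|E|%:R :> R by [].
  have A0 : 0 <= #|A|%:R :> R by [].
  by rewrite ler_norml; apply/andP; split; nra.
apply: (le_trans (le_bexp p01 fg)); rewrite /g.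
rewrite bexpD bexpD bexp1 !bexpZ bexp_var subrr expr0n addr0 /= -addrA lerD2l lerD2l.
have s01 : 0 <= s <= 2^-1 by rewrite ltW.
have h := bexp_cosh_le p01 s01 ks.
apply: (le_trans (ler_wpM2l _ h)).
  by rewrite mulr_ge0 ?ler0n // mulr_ge0 ?sqr_ge0 // invr_ge0 exprn_ge0 // ltW.
rewrite le_eqVlt; apply/orP; left; apply/eqP; field.
by rewrite gt_eqF.
Qed.

(** * Stars, degrees, and the tail bound for all [K] at once *)

Lemma gnp_probE (R : realType) (n : nat) (p : R) (Q : pred {set {set 'I_n}}) :
  gnp_prob p Q = bexp p (pairs n) (fun E => (Q E)%:R).
Proof.
rewrite /gnp_prob /bexp big_mkcondr; apply: eq_bigr => E _.
by case: (Q E); rewrite ?mulr1 ?mulr0.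
Qed.

(** The potential edges joining [i] to [K]. For [i] in [K] this would include the singleton of [i],
    which is not a pair; hence the condition [i \notin K] below. *)
Definition star (n : nat) (K : {set 'I_n}) (i : 'I_n) : {set {set 'I_n}} :=
  [set [set i; j] | j in K].

Lemma pair_inj (n : nat) (K : {set 'I_n}) (i : 'I_n) : i \notin K ->
  {in K &, injective (fun j => [set i; j])}.
Proof.
move=> iK j l jK lK /= /finset.setP /(_ j).
rewrite !inE eqxx orbT => /esym/orP[] /eqP // ji.
by rewrite -ji jK in iK.
Qed.

Lemma card_star (n : nat) (K : {set 'I_n}) (i : 'I_n) : i \notin K ->
  #|star K i| = #|K|.
Proof. by move=> iK; rewrite card_in_imset //; apply: pair_inj. Qed.

Lemma star_sub (n : nat) (K : {set 'I_n}) (i : 'I_n) : i \notin K ->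
  star K i \subset pairs n.
Proof.
move=> iK; apply/fintype.subsetP => e /imsetP[j jK ->].
by rewrite inE cards2; case: (eqVneq i j) => [ij|//]; rewrite ij jK in iK.
Qed.

(** A common edge would contain [i] and have the form [[set j; v]] with [v] in [K], forcing
    [i = v]. *)
Lemma star_disjoint (n : nat) (K : {set 'I_n}) (i j : 'I_n) :
  i \notin K -> j \notin K -> i != j -> [disjoint star K i & star K j].
Proof.
move=> iK jK ij; apply/pred0P => e /=; apply/negP => /andP[/imsetP[u uK ->]].
move=> /imsetP[v vK] /finset.setP /(_ i).
rewrite !inE eqxx (negbTE ij) /= => /esym/eqP iv.
by rewrite iv vK in iK.
Qed.

Lemma nbr_countE (n : nat) (E : {set {set 'I_n}}) (K : {set 'I_n}) (i : 'I_n) :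
  i \notin K -> nbr_count E K i = #|E :&: star K i|.
Proof.
move=> iK; rewrite /nbr_count -(@card_in_imset _ _ (fun j => [set i; j])); last first.
  by move=> j l; rewrite !inE => /andP[jK _] /andP[lK _]; apply: (pair_inj iK).
apply: eq_card => e; rewrite inE; apply/imsetP/andP => [[j]|[eE /imsetP[j jK ej]]].
  by rewrite inE => /andP[jK aj] ->; split => //; apply: imset_f.
by exists j => //; rewrite inE jK /adj -ej.
Qed.

(** The exponential of the sum is a product of functions of the traces on disjoint stars, so its
    mean factorises into [n - #|K|] binomial moments. *)
Lemma bexp_degree_mgf_le (R : realType) (n : nat) (p l s : R) (K : {set 'I_n}) :
  0 <= p <= 1 -> 0 <= l -> 0 < s <= 2^-1 ->
  #|K|%:R * p * s ^+ 2 <= 4^-1 -> 2 * (l * #|K|%:R) <= s ->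
  bexp p (pairs n) (fun E =>
    expR (l * \sum_(i in ~: K) ((nbr_count E K i)%:R - #|K|%:R * p) ^+ 2)) <=
  expR ((n - #|K|)%:R *
    (l * (#|K|%:R * p * (1 - p)) + 8 * 1024 * (l ^+ 2 * (#|K|%:R * p) / s ^+ 2))).
Proof.
move=> p01 l0 s0 ks lks.
pose g (i : 'I_n) (F : {set {set 'I_n}}) :=
  expR (l * (#|F|%:R - #|star K i|%:R * p) ^+ 2).
rewrite (eq_bexp _ (g := fun E =>
  \prod_(i <- enum (~: K)) g i (E :&: star K i))); last first.
  move=> E _; rewrite mulr_sumr expR_sum big_enum /=; apply: eq_bigr => i.
  by rewrite inE => iK; rewrite /g nbr_countE // card_star.
have mK i : i \in enum (~: K) -> i \notin K by rewrite mem_enum inE.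
rewrite bexp_prod ?enum_uniq //; last 2 first.
- by move=> i /mK; apply: star_sub.
- by move=> i j /mK iK /mK jK; apply: star_disjoint.
rewrite big_enum /=.
have -> : (n - #|K|)%N = #|~: K| by rewrite [RHS]cardsCs finset.setCK card_ord.
rewrite expRM_natl -prodr_const; apply: ler_prod => i; rewrite inE => iK.
apply/andP; split.
  by apply: sumr_ge0 => E _; rewrite !mulr_ge0 ?expR_ge0 // exprn_ge0 //;
    case/andP: p01 => // *; rewrite subr_ge0.
rewrite -(card_star iK) in ks lks *.
exact: bexp_expR_sqr_le.
Qed.

Lemma bin_le_exp (n k : nat) : ('C(n, k) <= n ^ k)%N.
Proof.
apply: (@leq_trans (n ^_ k)).
  by rewrite -bin_ffact leq_pmulr // fact_gt0.
elim: k => [|k IH]; first by rewrite ffactn0 expn0.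
by rewrite ffactnSr expnSr leq_mul // leq_subr.
Qed.

Lemma gnp_degree_tail (R : realType) (n k : nat) (p l s t : R) :
  0 <= p <= 1 -> 0 <= l -> 0 < s <= 2^-1 ->
  k%:R * p * s ^+ 2 <= 4^-1 -> 2 * (l * k%:R) <= s ->
  1 - (n ^ k)%:R * expR ((n - k)%:R * (8 * 1024 * (l ^+ 2 * (k%:R * p) / s ^+ 2)) - l * t)
  <= gnp_prob p
    (fun E => [forall K : {set 'I_n}, (#|K| == k) ==>
      (\sum_(i in ~: K) ((nbr_count E K i)%:R - k%:R * p) ^+ 2
        <= (n - k)%:R * k%:R * p * (1 - p) + t)]).
Proof.
move=> p01 l0 s0 ks lks.
pose S (E : {set {set 'I_n}}) (K : {set 'I_n}) :=
  \sum_(i in ~: K) ((nbr_count E K i)%:R - k%:R * p) ^+ 2.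
pose m := (n - k)%:R * k%:R * p * (1 - p) + t.
pose Q (E : {set {set 'I_n}}) := [forall K : {set 'I_n}, (#|K| == k) ==> (S E K <= m)].
rewrite -[X in _ <= X]/(gnp_prob p Q) gnp_probE lerBlDl -lerBlDr.
(* Markov and union bound, pointwise: if the event fails at [E], a violating [K] contributes a term
   of at least 1. *)
have h1 : bexp p (pairs n) (fun E => 1) - bexp p (pairs n) (fun E => (Q E)%:R) <=
    bexp p (pairs n) (fun E =>
      \sum_(K : {set 'I_n} | #|K| == k) expR (- (l * m)) * expR (l * S E K)).
  rewrite lerBlDr -bexpD; apply: le_bexp => // E _.
  have sge0 : 0 <= \sum_(K : {set 'I_n} | #|K| == k) expR (- (l * m)) * expR (l * S E K).
    by apply: sumr_ge0 => K _; rewrite mulr_ge0 ?expR_ge0.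
  case: (boolP (Q E)) => [_|]; first by rewrite lerDr.
  rewrite /Q negb_forall => /existsP[K]; rewrite negb_imply -ltNge => /andP[cK hK].
  rewrite addr0 (bigD1 K) //= ler_wpDr //.
    by apply: sumr_ge0 => K' _; rewrite mulr_ge0 ?expR_ge0.
  rewrite -expRD -[leLHS]expR0 ler_expR addrC -mulrBr mulr_ge0 // subr_ge0 ltW //.
rewrite bexp1 in h1; apply: (le_trans h1).
rewrite bexp_sum.
have h2 (K : {set 'I_n}) : #|K| == k ->
    bexp p (pairs n) (fun E => expR (- (l * m)) * expR (l * S E K)) <=
    expR ((n - k)%:R * (8 * 1024 * (l ^+ 2 * (k%:R * p) / s ^+ 2)) - l * t).
  move=> /eqP cK; rewrite bexpZ /S; subst k.
  apply: (le_trans (ler_wpM2l (expR_ge0 _) (bexp_degree_mgf_le p01 l0 s0 ks lks))).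
  (* The variance part of the moment bound cancels against [l * m], leaving the second order term
     and [- l * t]. *)
  by rewrite -expRD ler_expR /m; lra.
apply: (le_trans (ler_sum _ h2)).
rewrite sumr_const -[_ *+ #|_|]mulr_natl ler_wpM2r ?expR_ge0 // ler_nat.
have -> : #|[pred K : {set 'I_n} | #|K| == k]| = 'C(n, k).
  by rewrite -[in RHS](card_ord n) -card_draws; apply: eq_card => K; rewrite !inE.
exact: bin_le_exp.
Qed.

(** * Choice of a vanishing error term *)

(* Diagonal choice: f n uses the largest m <= n for which the error
   D n / (m + 1) is admissible. *)
Lemma ex_vanishing_choice (R : realType) (P : nat -> R -> bool) (D : nat -> R) :
  (forall n, exists t, P n t) ->
  (forall e : R, 0 < e -> exists N, forall n, (N <= n)%N -> P n (e * D n)) ->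
  exists f : nat -> R,
    (forall e : R, 0 < e -> exists N, forall n, (N <= n)%N -> `|f n / D n| <= e) /\
    forall n, P n (f n).
Proof.
move=> Pex Pev.
pose good (n m : nat) := P n (m.+1%:R^-1 * D n).
have fex n : exists t, P n t /\
    (forall M, (M <= n)%N -> good n M -> `|t / D n| <= M.+1%:R^-1).
  case: (boolP [exists m : 'I_n.+1, good n m]) => [/existsP[m0 gm0]|].
    have [m gm mmax] :=
      @arg_maxnP _ m0 (fun m : 'I_n.+1 => good n m) (fun m : 'I_n.+1 => m : nat) gm0.
    exists (m.+1%:R^-1 * D n); split => // M Mn gM.
    have Mm : (M <= m)%N.
      have := mmax (Ordinal (Mn : (M < n.+1)%N)); apply. exact: gM.
    have [->|D0] := eqVneq (D n) 0; first by rewrite mulr0 mul0r normr0 invr_ge0.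
    rewrite mulfK // ger0_norm ?invr_ge0 // lef_pV2 ?posrE ?ltr0n // ler_nat.
    by rewrite ltnS.
  (* No candidate is admissible, so the size condition is vacuous and any [t] serves. *)
  rewrite negb_exists => /forallP ng; have [t Pt] := Pex n.
  exists t; split => // M Mn gM.
  by have := ng (Ordinal (Mn : (M < n.+1)%N)); rewrite gM.
have [f fP] := choice fex.
exists f; split => [e e0|n]; last by case: (fP n).
have [M Me] : exists M : nat, M.+1%:R^-1 <= e.
  exists (Num.truncn e^-1); rewrite invf_ple ?posrE ?ltr0n //.
  exact/ltW/truncnS_gt.
have M0 : 0 < M.+1%:R^-1 :> R by rewrite invr_gt0.
have [N NP] := Pev _ M0.
(* [N] makes the candidate with index [M] admissible, and [M <= n] puts it in the range searched. *)
exists (maxn N M) => n; rewrite geq_max => /andP[Nn Mn].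
by apply: le_trans Me; case: (fP n) => _; apply => //; apply: NP.
Qed.

Lemma gnp_prob_true (R : realType) (n : nat) (p : R) (Q : pred {set {set 'I_n}}) :
  (forall E, Q E) -> gnp_prob p Q = 1.
Proof.
move=> QT; rewrite gnp_probE -[RHS](bexp1 p (pairs n)).
by apply: eq_bexp => E _; rewrite QT.
Qed.

(** * Numerical choice of the tilt [l] and the scale [s] *)

Lemma ln2_bounds (R : realType) : 2^-1 <= ln (2 : R) <= 1.
Proof.
have e2 : 0 < (2 : R) by [].
rewrite -(ler_expR (2^-1)) -(ler_expR (ln _)) lnK ?posrE //.
apply/andP; split; last by have := expR_ge1Dx (1 : R); lra.
have := expR_ge1Dx (- 2^-1 : R); rewrite expRN => h.
by rewrite -[expR _]invrK -[leRHS]invrK lef_pV2 ?posrE ?invr_gt0 ?expR_gt0 //; lra.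
Qed.

(* Here u = sqrt w, r = sqrt n, L = ln n and x = k. *)
Lemma tilt_bounds (R : realType) (A C L u r x : R) :
  0 < A -> 0 < C -> 1 <= L -> L ^+ 2 <= u -> u <= r -> L ^+ 3 <= 48 * r ->
  0 <= x <= C * u ->
  let l := A * L / u ^+ 2 in let kp := x * (u ^+ 2 / r ^+ 2) in
  l * (1 + kp) * L <= A + 48 * A * C /\
  (l * x) ^+ 2 * (1 + kp) * L <= (A * C) ^+ 2 + 48 * A ^+ 2 * C ^+ 3.
Proof.
move=> A0 C0 L1 Lu ur Lr /andP[x0 xu] l kp.
have L2 : 1 <= L ^+ 2 by rewrite exprn_ege1.
have u0 : 0 < u by lra.
have r0 : 0 < r by lra.
have l0 : 0 <= l by rewrite /l !mulr_ge0 ?invr_ge0 ?exprn_ge0; lra.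
have kp0 : 0 <= kp by rewrite /kp !mulr_ge0 ?invr_ge0 ?exprn_ge0; lra.
have AC0 : 0 < A * C by rewrite mulr_gt0.
have lL : l * L <= A.
  rewrite /l mulrAC ler_pdivrMr ?exprn_gt0 // -mulrA -expr2 (ler_wpM2l (ltW A0)) //.
  by apply: (le_trans Lu); rewrite expr2 ler_peMr //; lra.
have lx : l * x * L <= A * C.
  have -> : l * x * L = A * L ^+ 2 * x / u ^+ 2 by rewrite /l; field; rewrite gt_eqF.
  rewrite ler_pdivrMr ?exprn_gt0 //.
  apply: (@le_trans _ _ (A * L ^+ 2 * (C * u))).
    by rewrite ler_wpM2l // mulr_ge0 ?exprn_ge0; lra.
  rewrite (_ : A * L ^+ 2 * (C * u) = A * C * u * L ^+ 2); last by ring.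
  by rewrite [u ^+ 2]expr2 [leRHS]mulrA ler_wpM2l //; apply: mulr_ge0; lra.
(* The second power of [L] is kept because the last bound multiplies [l * kp * L] by [l * x ^+ 2],
   which costs another factor [L]. *)
have lkp : l * kp * L ^+ 2 <= 48 * A * C.
  have -> : l * kp * L ^+ 2 = A * L ^+ 3 * x / r ^+ 2.
    by rewrite /l /kp; field; rewrite !gt_eqF.
  rewrite ler_pdivrMr ?exprn_gt0 //.
  apply: (@le_trans _ _ (A * (48 * r) * (C * r))).
    apply: ler_pM => //; first by rewrite mulr_ge0 ?exprn_ge0; lra.
      by rewrite ler_wpM2l //; lra.
    by apply: (le_trans xu); rewrite ler_wpM2l //; lra.
  by rewrite le_eqVlt; apply/orP; left; apply/eqP; ring.
have L0 : 0 <= L by lra.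
have lkp0 : 0 <= l * kp * L := mulr_ge0 (mulr_ge0 l0 kp0) L0.
have lx0 : 0 <= l * x * L := mulr_ge0 (mulr_ge0 l0 x0) L0.
have lkp1 : l * kp * L <= 48 * A * C.
  by apply: le_trans lkp; rewrite expr2 [leRHS]mulrA ler_peMr.
split; first by rewrite mulrDr mulr1 mulrDl lerD.
rewrite mulrDr mulr1 mulrDl lerD //.
  apply: (@le_trans _ _ ((l * x * L) ^+ 2)).
    rewrite [leRHS]exprMn ler_wpM2l ?sqr_ge0 // expr2 ler_peMr //; lra.
  by apply: lerXn2r; rewrite ?nnegrE // ltW.
have lxx : l * x ^+ 2 <= A * C ^+ 2 * L.
  have -> : l * x ^+ 2 = A * L * (x ^+ 2 / u ^+ 2) by rewrite /l; field; rewrite gt_eqF.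
  rewrite mulrAC ler_wpM2r ?(le_trans ler01 L1) // (ler_wpM2l (ltW A0)) //.
  rewrite ler_pdivrMr ?exprn_gt0 // -exprMn.
  by apply: lerXn2r; rewrite ?nnegrE //; apply: mulr_ge0; lra.
have -> : (l * x) ^+ 2 * kp * L = l * kp * L * (l * x ^+ 2) by ring.
have -> : 48 * A ^+ 2 * C ^+ 3 = 48 * A * C * (A * C ^+ 2) by ring.
apply: (le_trans (ler_wpM2l lkp0 lxx)).
rewrite (_ : _ * (_ * L) = l * kp * L ^+ 2 * (A * C ^+ 2)); last by ring.
by rewrite ler_wpM2r // mulr_ge0 ?exprn_ge0 // ltW.
Qed.

(* A makes the Chernoff gain equal to at least 10 k ln n; the union bound costs
   k ln n, the second order term at most k ln n, and the target probability at
   most 4 k ln n, as log2 n <= 2 ln n. *)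
Lemma gnp_degree_tail_log (R : realType) (e c C w : R) (n k : nat) :
  0 < e -> 0 < c < 1 -> 0 < C -> 0 < w < c * n%:R -> k%:R <= C * Num.sqrt w ->
  let L := ln (n%:R : R) in let A := 10 / (e * (1 - c)) in
  1 <= L -> L ^+ 4 <= w ->
  8 * 1024 * 4 * A * (A + 48 * A * C) <= L ->
  16 * ((A * C) ^+ 2 + 48 * A ^+ 2 * C ^+ 3) <= L ->
  1 - expR (- (2 * k%:R * log2 (n%:R : R)))
  <= gnp_prob (w / n%:R)
    (fun E => [forall K : {set 'I_n}, (#|K| == k) ==>
      (\sum_(i in ~: K) ((nbr_count E K i)%:R - k%:R * (w / n%:R)) ^+ 2
        <= (n - k)%:R * k%:R * (w / n%:R) * (1 - w / n%:R)
           + e * (n%:R * k%:R * (w / n%:R) * (1 - w / n%:R)))]).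
Proof.
move=> e0 /andP[c0 c1] C0 /andP[w0 wc] kC L A L1 Lw LA LA2.
have n0 : 0 < (n%:R : R) by have := lt_trans w0 wc; rewrite pmulr_rgt0.
have wn : w <= n%:R by apply: (le_trans (ltW wc)); rewrite ler_piMl ?ltW.
have A0 : 0 < A by rewrite divr_gt0 // mulr_gt0 //; lra.
have L0 : 0 < L by lra.
have nE : n%:R = expR L by rewrite /L lnK.
set u := Num.sqrt w in kC.
have u0 : 0 < u by rewrite sqrtr_gt0.
have u2 : u ^+ 2 = w by rewrite sqr_sqrtr ?ltW.
pose r := expR (L / 2).
have r0 : 0 < r by apply: expR_gt0.
have r2 : r ^+ 2 = n%:R by rewrite nE /r -expRM_natl; congr expR; field.
have ur : u <= r by rewrite -ler_sqr ?nnegrE ?(ltW u0) ?(ltW r0) // u2 r2.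
have Lu : L ^+ 2 <= u.
  by rewrite -ler_sqr ?nnegrE ?sqr_ge0 ?(ltW u0) // u2 -exprM.
(* The cubic Taylor term of [r = expR (L / 2)] is [(L / 2)^3 / 6 = L^3 / 48]. *)
have Lr : L ^+ 3 <= 48 * r.
  have L20 : 0 <= L / 2 by lra.
  have := expR_ge1Dxn 2 L20; rewrite -/r (_ : (3`!)%:R = 6 :> R) // => h.
  have -> : L ^+ 3 = 48 * ((L / 2) ^+ 3 / 6) by field.
  by rewrite ler_pM2l //; lra.
have x0 : 0 <= (k%:R : R) <= C * u by rewrite ler0n.
have := tilt_bounds A0 C0 L1 Lu ur Lr x0.
rewrite /= u2 r2; set p := w / n%:R; set l := A * L / w; set x := (k%:R : R) => -[h1 h2].
have l0 : 0 < l by rewrite divr_gt0 // mulr_gt0.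
have p0 : 0 <= p by rewrite divr_ge0 ?ltW.
have pc : p <= c by rewrite ler_pdivrMr // ltW.
have p01 : 0 <= p <= 1 by rewrite p0 /=; lra.
have x00 : 0 <= x by case/andP: x0.
have xp0 : 0 <= x * p by rewrite mulr_ge0.
pose v := Num.sqrt (1 + x * p).
have v0 : 0 < v by rewrite sqrtr_gt0; lra.
have v2 : v ^+ 2 = 1 + x * p by rewrite sqr_sqrtr //; lra.
pose s := (2 * v)^-1.
have s0 : 0 < s by rewrite invr_gt0 mulr_gt0.
have v1 : 1 <= v by rewrite -ler_sqr ?nnegrE ?(ltW v0) // v2 expr1n; lra.
have s2 : s ^+ 2 = (4 * (1 + x * p))^-1.
  by rewrite /s exprVn; congr (_^-1); rewrite exprMn v2; congr (_ * _); ring.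
have s01 : 0 < s <= 2^-1.
  by rewrite s0 /= /s lef_pV2 ?posrE ?mulr_gt0 //; lra.
have ks : x * p * s ^+ 2 <= 4^-1.
  by rewrite s2 ler_pdivrMr; lra.
have lks : 2 * (l * x) <= s.
  rewrite /s -div1r ler_pdivlMr ?mulr_gt0 //.
  have -> : 2 * (l * x) * (2 * v) = 4 * (l * x * v) by ring.
  (* Squaring removes the root [v]; after multiplication by [L], this follows from [h2] and
     [LA2]. *)
  have : (4 * (l * x * v)) ^+ 2 <= 1 ^+ 2.
    rewrite (_ : _ ^+ 2 = 16 * ((l * x) ^+ 2 * v ^+ 2)); last by ring.
    rewrite v2 expr1n -(ler_pM2r L0) mul1r; apply: le_trans LA2.
    by rewrite -[leLHS]mulrA ler_wpM2l.
  have q0 : 0 <= 4 * (l * x * v).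
    by rewrite mulr_ge0 // mulr_ge0 ?(ltW v0) // mulr_ge0 ?(ltW l0).
  by rewrite ler_sqr ?nnegrE ?q0 ?ler01.
apply: le_trans (@gnp_degree_tail R n k p l s (e * (n%:R * x * p * (1 - p)))
  p01 (ltW l0) s01 ks lks).
rewrite lerD2l lerN2.
have -> : (n ^ k)%:R = expR (x * L) :> R by rewrite natrX expRM_natl nE.
rewrite -expRD ler_expR.
have b1 : (n - k)%:R * (8 * 1024 * (l ^+ 2 * (x * p) / s ^+ 2)) <= x * L.
  apply: (@le_trans _ _ (n%:R * (8 * 1024 * (l ^+ 2 * (x * p) / s ^+ 2)))).
    apply: ler_wpM2r; last by rewrite ler_nat leq_subr.
    apply: mulr_ge0; first by apply: mulr_ge0; apply: ler0n.
    by rewrite mulr_ge0 ?invr_ge0 ?sqr_ge0 // mulr_ge0 ?sqr_ge0.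
  rewrite s2 invrK.
  have -> : n%:R * (8 * 1024 * (l ^+ 2 * (x * p) * (4 * (1 + x * p)))) =
      x * (8 * 1024 * 4 * A * (l * (1 + x * p) * L)).
    by rewrite /p /l; field; rewrite !gt_eqF.
  apply: (ler_wpM2l x00); apply: (le_trans _ LA); apply: ler_wpM2l; last exact: h1.
  apply: mulr_ge0; last exact: ltW.
  by apply: mulr_ge0; [apply: mulr_ge0|]; apply: ler0n.
(* Since [l * n * p = A * L] and [1 - p >= 1 - c], the choice of [A] leaves exactly 10. *)
have b2 : 10 * (x * L) <= l * (e * (n%:R * x * p * (1 - p))).
  have -> : l * (e * (n%:R * x * p * (1 - p))) = A * e * (1 - p) * (x * L).
    by rewrite /p /l; field; rewrite !gt_eqF.
  apply: ler_wpM2r; first by rewrite mulr_ge0 // ltW.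
  have -> : 10 = A * e * (1 - c) by rewrite /A; field; rewrite !gt_eqF //; lra.
  by apply: ler_wpM2l; [rewrite mulr_ge0 // ltW | lra].
have /andP[ln2l ln2u] := ln2_bounds R.
have b3 : 2 * x * log2 n%:R <= 4 * (x * L).
  rewrite /log2 -/L mulrA ler_pdivrMr; last by lra.
  have : 0 <= (x * L) * (ln 2 - 2^-1) by rewrite !mulr_ge0 //; lra.
  lra.
have xL : 0 <= x * L by rewrite mulr_ge0 // ltW.
lra.
Qed.

(** * Small and large [n], and the asymptotic conclusion *)

Unset Implicit Arguments.
Local Open Scope classical_set_scope.
Local Open Scope ring_scope.

Theorem theoremD1 (R : realType) (c C : R) (w : nat -> R) :
  0 < c < 1 -> 0 < C ->
  (fun n : nat => log2 (n%:R : R) ^+ 4 / w n) @ \oo --> 0 ->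
  (forall n : nat, w n < c * n%:R) ->
  exists f : nat -> R,
    (fun n : nat =>
        f n / (n%:R * (kk C w n)%:R * pp w n * (1 - pp w n))) @ \oo --> 0
    /\
    forall n : nat,
      1 - expR (- (2 * (kk C w n)%:R * log2 (n%:R : R)))
      <= gnp_prob (pp w n)
           (fun E => [forall K : {set 'I_n},
              (#|K| == kk C w n) ==>
              (\sum_(i in ~: K)
                  ((nbr_count E K i)%:R - (kk C w n)%:R * pp w n) ^+ 2
               <= (n - kk C w n)%:R * (kk C w n)%:R * pp w n * (1 - pp w n)
                  + f n)]).
Proof.
move=> c01 C0 wlim wc.
have /andP[c0 c1] := c01.
pose S n (E : {set {set 'I_n}}) (K : {set 'I_n}) :=
  \sum_(i in ~: K) ((nbr_count E K i)%:R - (kk C w n)%:R * pp w n) ^+ 2.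
pose m n := (n - kk C w n)%:R * (kk C w n)%:R * pp w n * (1 - pp w n).
pose D n := n%:R * (kk C w n)%:R * pp w n * (1 - pp w n).
pose P n t := 1 - expR (- (2 * (kk C w n)%:R * log2 (n%:R : R)))
  <= gnp_prob (pp w n) (fun E => [forall K : {set 'I_n},
       (#|K| == kk C w n) ==> (S n E K <= m n + t)]).
have Psure n t :
    (forall E (K : {set 'I_n}), #|K| = kk C w n -> S n E K <= m n + t) -> P n t.
  move=> SE; rewrite /P gnp_prob_true ?lerBlDr ?lerDl ?expR_ge0 // => E.
  by apply/forallP => K; apply/implyP => /eqP; apply: SE.
suff [f [f0 Pf]] : exists f : nat -> R,
    (forall e : R, 0 < e -> exists N, forall n, (N <= n)%N -> `|f n / D n| <= e) /\
    forall n, P n (f n).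
  exists f; split => //; apply/cvgrPdist_le => e e0; have [N fN] := f0 e e0.
  near=> n; rewrite sub0r normrN; apply: fN; near: n.
  exact: nbhs_infty_ge.
apply: ex_vanishing_choice => [n|e e0].
  (* This error dominates every deviation, so the event is sure. Its weight is 1 even when [pp w n]
     lies outside [[0, 1]]. *)
  exists (\sum_E \sum_K `|S n E K - m n|); apply: Psure => E K _.
  rewrite -lerBlDl; apply: (le_trans (ler_norm _)).
  rewrite (bigD1 E) //= (bigD1 K) //= -addrA lerDl addr_ge0 ?sumr_ge0 // => *.
  by rewrite sumr_ge0.
pose A := 10 / (e * (1 - c)).
(* The three lower bounds on [ln n] demanded by [gnp_degree_tail_log]. *)
pose L0 := Num.max 1 (Num.max (8 * 1024 * 4 * A * (A + 48 * A * C))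
  (16 * ((A * C) ^+ 2 + 48 * A ^+ 2 * C ^+ 3))).
have [N _ wN] : \forall n \near \oo, `|log2 (n%:R : R) ^+ 4 / w n| < 1.
  have := cvgr0_norm_lt _ wlim _ ltr01.
  by apply.
exists (maxn N (Num.truncn (expR L0)).+1) => n.
rewrite geq_max => /andP[/wN /= wn nL].
(* The limit does not force [w n > 0]: a quotient by 0 is 0, and negative values of large modulus
   are allowed. Then [K] is empty and both sides vanish. *)
have [w0|w0] := leP (w n) 0.
  have k0 : kk C w n = 0%N by rewrite /kk ler0_sqrtr // mulr0 truncn0.
  apply: Psure => E K; rewrite k0 => /eqP; rewrite cards_eq0 => /eqP ->.
  rewrite /m /D k0 !(mulr0, mul0r) addr0 /S big1 // => i _.
  have -> : nbr_count E finset.set0 i = 0%N.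
    by apply/eqP; rewrite cards_eq0; apply/eqP/finset.setP => j; rewrite !inE.
  by rewrite k0 mul0r subr0 expr0n.
have eL : expR L0 <= n%:R.
  by apply: (le_trans (ltW (truncnS_gt _))); rewrite ler_nat.
have n0 : 0 < (n%:R : R) by apply: lt_le_trans eL; apply: expR_gt0.
have : L0 <= ln n%:R by rewrite -ler_expR lnK.
rewrite !ge_max => /and3P[L1 LA LA2].
have /andP[ln2l ln2u] := ln2_bounds R.
(* The limit gives this for [log2], and [ln n <= log2 n] because [ln 2 <= 1]. *)
have Lw : ln n%:R ^+ 4 <= w n.
  move: wn; rewrite normrM normfV (gtr0_norm w0) ltr_pdivrMr // mul1r => /ltW.
  apply: le_trans; apply: (le_trans _ (ler_norm _)).
  apply: lerXn2r; rewrite ?nnegrE; try lra.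
    by rewrite /log2 divr_ge0; lra.
  by rewrite /log2 ler_pdivlMr; [rewrite ler_piMr; lra|lra].
apply: (gnp_degree_tail_log e0 c01 C0 _ _ L1 Lw LA LA2); first by rewrite w0 wc.
by rewrite truncn_le mulr_ge0 ?sqrtr_ge0 ?ltW.
Unshelve. all: by end_near.
Qed.
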